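(* Let $N\ge 1$, $\sigma_d>0$, $\sigma_{1/TTC}>0$ and $0<a<1$. For each timestep $k=1,\dots,N$ of a robot trajectory, let $d_{o,k}\in[0,\infty)$ be the distance to the closest obstacle and $TTC_k\in[0,\infty]$ the time to collision. Define the original collision probability $$p_{c_k}=\exp\left(-\frac{d_{o,k}^2}{\sigma_d^2}\right)$$ and the modified collision probability $$\tilde p_{c_k}=\exp\left(-\frac{d_{o,k}^2}{\sigma_d^2}\right)\left(1-a\exp\left(-\frac{(1/TTC_k)^2}{\sigma_{1/TTC}^2}\right)\right),$$ and the corresponding survivabilities $$p_{s_i}=\prod_{k=1}^i(1-p_{c_k}),\qquad \tilde p_{s_i}=\prod_{k=1}^i(1-\tilde p_{c_k}),\qquad i=1,\dots,N.$$ Then the modified survivability is at least the original survivability: $\tilde p_{s_i}\ge p_{s_i}$ for every $i\in\{1,\dots,N\}$.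
   Context: Time to collision ($TTC$) is the time in the future before a collision if the robot and the obstacle continue their current motion; $TTC=0$ means the robot is already in collision, and $TTC=\infty$ means no collision ever occurs under the current velocities. Conventions: $1/TTC=0$ when $TTC=\infty$; when $TTC=0$, $1/TTC=\infty$ and $\exp(-(1/TTC)^2/\sigma_{1/TTC}^2)=0$. The parameter $a$ is a weight limiting the effect of the time-to-collision term. *)

(* Defs.v *)
From mathcomp Require Import all_boot all_order all_algebra.
From mathcomp Require Import all_classical all_reals all_analysis.

Set Implicit Arguments.
Unset Strict Implicit.
Unset Printing Implicit Defensive.

Import Order.TTheory GRing.Theory Num.Theory.
Local Open Scope ring_scope.

Definition collision_prob (R : realType) (sigma_d d : R) : R :=
  expR (- (d ^+ 2 / sigma_d ^+ 2)).

(* exp(-(1/TTC)^2 / sigma^2) for TTC in [0, +oo], evaluated in the extended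
   reals, where 0^-1 = +oo, +oo^-1 = 0 and expeR -oo = 0.  For TTC >= 0 and
   sigma > 0 the extended value lies in [0, 1], so that [fine] loses nothing. *)
Definition ttc_term (R : realType) (sigma_t : R) (ttc : \bar R) : R :=
  fine (expeR (- ((ttc^-1) ^+ 2 / (sigma_t ^+ 2)%:E))%E).

Definition modified_collision_prob (R : realType) (sigma_d sigma_t a d : R)
    (ttc : \bar R) : R :=
  collision_prob sigma_d d * (1 - a * ttc_term sigma_t ttc).

Definition survivability (R : realType) (p : nat -> R) (i : nat) : R :=
  \prod_(1 <= k < i.+1) (1 - p k).

Lemma ttc_term0 (R : realType) (sigma_t : R) :
  0 < sigma_t -> ttc_term sigma_t 0%E = 0.
Proof.
move=> s0; have s2 : sigma_t ^+ 2 != 0 by rewrite expf_neq0 ?gt_eqF.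
rewrite /ttc_term inve0 expe2 mulyy inver (negbTE s2) gt0_mulye //.
by rewrite lte_fin invr_gt0 exprn_gt0.
Qed.

Lemma ttc_termy (R : realType) (sigma_t : R) : ttc_term sigma_t +oo%E = 1.
Proof. by rewrite /ttc_term invey expe2 !mul0e oppe0 expeR0. Qed.

Lemma ttc_term_fin (R : realType) (sigma_t t : R) :
  0 < sigma_t -> 0 < t ->
  ttc_term sigma_t t%:E = expR (- ((1 / t) ^+ 2 / sigma_t ^+ 2)).
Proof.
move=> s0 t0; have s2 : sigma_t ^+ 2 != 0 by rewrite expf_neq0 ?gt_eqF.
by rewrite /ttc_term !inver (negbTE s2) gt_eqF // div1r -EFin_expe.
Qed.

(* Main.v *)
Require Import Defs.
From mathcomp Require Import all_boot all_order all_algebra.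
From mathcomp Require Import all_classical all_reals all_analysis.
Import Order.TTheory GRing.Theory Num.Theory.
Local Open Scope ring_scope.

(** The time-to-collision factor [1 - a * ttc_term] never exceeds 1, so it can only lower each
    collision probability ([modified_collision_prob_le]) and hence raise each survival factor. As
    the original probabilities are at most 1, all factors are nonnegative and the comparison passes
    to the products ([le_survivability]). *)

Lemma collision_prob_le1 (R : realType) (sigma_d d : R) :
  collision_prob sigma_d d <= 1.
Proof. by rewrite -expR0 ler_expR oppr_le0 divr_ge0 ?sqr_ge0. Qed.

(** [expeR] is nonnegative on all extended reals, and [fine] keeps this, as it sends infinities to
    0. *)
Lemma ttc_term_ge0 (R : realType) (sigma_t : R) (ttc : \bar R) :
  0 <= ttc_term sigma_t ttc.
Proof. exact/fine_ge0/expeR_ge0. Qed.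

Lemma modified_collision_prob_le (R : realType) (sigma_d sigma_t a d : R)
    (ttc : \bar R) : 0 <= a ->
  modified_collision_prob sigma_d sigma_t a d ttc <= collision_prob sigma_d d.
Proof.
move=> a0; apply: ler_piMr; first exact: expR_ge0.
by rewrite gerBl mulr_ge0 ?ttc_term_ge0.
Qed.

(** The bound [p k <= 1] keeps the smaller factors [1 - p k] nonnegative, which multiplying
    inequalities factor by factor requires. *)
Lemma le_survivability (R : realType) (p q : nat -> R) (i : nat) :
  (forall k, q k <= p k <= 1) -> survivability p i <= survivability q i.
Proof.
move=> qp1; apply: ler_prod => k _; have /andP[qp p1] := qp1 k.
by rewrite subr_ge0 p1 lerB.
Qed.

Theorem mainTheorem1 (R : realType) (N : nat) (sigma_d sigma_t a : R)
    (d : nat -> R) (ttc : nat -> \bar R)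
    (hN : (1 <= N)%N) (hsigma_d : 0 < sigma_d) (hsigma_t : 0 < sigma_t)
    (ha0 : 0 < a) (ha1 : a < 1)
    (hd : forall k : nat, (1 <= k <= N)%N -> 0 <= d k)
    (httc : forall k : nat, (1 <= k <= N)%N -> (0 <= ttc k)%E) :
  forall i : nat, (1 <= i <= N)%N ->
    survivability (fun k => collision_prob sigma_d (d k)) i <=
    survivability
      (fun k => modified_collision_prob sigma_d sigma_t a (d k) (ttc k)) i.
Proof.
move=> i _; apply: le_survivability => k.
by rewrite collision_prob_le1 andbT modified_collision_prob_le // ltW.
Qed.
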